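(* Let $G$ be a finite simple graph with $n$ vertices. Then (1) $Z(G)=n-\gamma_{\rm gr}^Z(G)$; (2) $Z_{\dot\ell}(G)=n-\gamma_{\rm gr}(G)$; (3) $Z_-(G)=n-\gamma_{\rm gr}^t(G)$; (4) $Z_L(G)=n-\gamma_{\rm gr}^L(G)$.
   Context: $N(x)$ and $N[x]$ denote open and closed neighborhoods. Vertices are colored blue or white and a color change rule is applied repeatedly. Rules: (CCR-$Z$) if $y\in N(x)$ and all of $N[x]$ is blue except $y$, then $y$ turns blue; (CCR-$Z_{\dot\ell}$) if $y\in N[x]$ and all of $N[x]$ is blue except $y$, then $y$ turns blue ($y=x$ allowed); (CCR-$Z_-$) if $y\in N(x)$ and all of $N(x)$ is blue except $y$, then $y$ turns blue; (CCR-$Z_L$) either $x\ne y$ and the CCR-$Z_-$ force from $x$ to $y$ applies, or $x=y$ and the CCR-$Z_{\dot\ell}$ force from $x$ to $x$ applies. A set $B$ is a zero forcing set for a rule if starting with $B$ blue and applying the rule repeatedly turns every vertex blue; $Z(G),Z_{\dot\ell}(G),Z_-(G),Z_L(G)$ are the minimum sizes of zero forcing sets for CCR-$Z$, CCR-$Z_{\dot\ell}$, CCR-$Z_-$, CCR-$Z_L$ respectively. A sequence $(v_1,\ldots,v_k)$ of distinct vertices is a $Z$-sequence if $N(v_i)\setminus\bigcup_{j<i}N[v_j]\ne\emptyset$ for all $i$; a dominating sequence if $N[v_i]\setminus\bigcup_{j<i}N[v_j]\ne\emptyset$; a total dominating sequence if $N(v_i)\setminus\bigcup_{j<i}N(v_j)\ne\emptyset$;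 an $L$-sequence if $N[v_i]\setminus\bigcup_{j<i}N(v_j)\ne\emptyset$. $\gamma_{\rm gr}^Z(G),\gamma_{\rm gr}(G),\gamma_{\rm gr}^t(G),\gamma_{\rm gr}^L(G)$ are the maximum lengths of a $Z$-sequence, dominating sequence, total dominating sequence, and $L$-sequence, respectively. *)

(* Defs.v *)
(* A finite simple graph is a symmetric irreflexive relation
   [e : rel V] on a finite type [V]. *)
From mathcomp Require Import all_boot.
Set Implicit Arguments.
Unset Strict Implicit.
Unset Printing Implicit Defensive.

Definition opn (V : finType) (e : rel V) (x : V) : {set V} := [set y | e x y].
Definition cln (V : finType) (e : rel V) (x : V) : {set V} := x |: opn e x.

(* A color change rule: [ccr B x y] means that, when [B] is the set of blue
   vertices, [x] may force the white vertex [y]. *)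
Definition color_rule (V : finType) : Type := {set V} -> V -> V -> bool.

(* "All of [A] is blue except [y]": [y] is the unique white vertex of [A]. *)
Definition all_blue_except (V : finType) (B A : {set V}) (y : V) : bool :=
  A :\: B == [set y].

Definition ccr_Z (V : finType) (e : rel V) : color_rule V := fun B x y =>
  (y \in opn e x) && all_blue_except B (cln e x) y.

Definition ccr_Zl (V : finType) (e : rel V) : color_rule V := fun B x y =>
  (y \in cln e x) && all_blue_except B (cln e x) y.

Definition ccr_Zminus (V : finType) (e : rel V) : color_rule V := fun B x y =>
  (y \in opn e x) && all_blue_except B (opn e x) y.

Definition ccr_ZL (V : finType) (e : rel V) : color_rule V := fun B x y =>
  ((x != y) && ccr_Zminus e B x y) || ((x == y) && ccr_Zl e B x x).

Definition color_step (V : finType) (ccr : color_rule V) : rel {set V} :=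
  fun B B' => [exists x, exists y, ccr B x y && (B' == y |: B)].

Definition zero_forcing (V : finType) (ccr : color_rule V) (B : {set V}) :
  bool := connect (color_step ccr) B [set: V].

Lemma zero_forcingT (V : finType) (ccr : color_rule V) :
  zero_forcing ccr [set: V].
Proof. exact: connect0. Qed.

(* By [zero_forcingT], [arg min] is an actual minimizer. *)
Definition forcing_number (V : finType) (ccr : color_rule V) : nat :=
  #|[arg min_(B < [set: V] | zero_forcing ccr B) #|B|]|.

Definition Z_number (V : finType) (e : rel V) := forcing_number (ccr_Z e).
Definition Zl_number (V : finType) (e : rel V) := forcing_number (ccr_Zl e).
Definition Zminus_number (V : finType) (e : rel V) :=
  forcing_number (ccr_Zminus e).
Definition ZL_number (V : finType) (e : rel V) := forcing_number (ccr_ZL e).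

(* Distinct vertices [s_0, ..., s_(k-1)] such that each [A s_i] is not covered
   by the [C s_j] with [j < i]. *)
Definition grundy_seq (V : finType) (A C : V -> {set V})
    (k : nat) (s : k.-tuple V) : bool :=
  uniq s && [forall i : 'I_k,
    A (tnth s i) :\: \bigcup_(j < k | j < i) C (tnth s j) != set0].

Definition Z_seq (V : finType) (e : rel V) (k : nat) (s : k.-tuple V) :=
  grundy_seq (opn e) (cln e) s.
Definition dominating_seq (V : finType) (e : rel V) (k : nat)
    (s : k.-tuple V) := grundy_seq (cln e) (cln e) s.
Definition total_dominating_seq (V : finType) (e : rel V) (k : nat)
    (s : k.-tuple V) := grundy_seq (opn e) (opn e) s.
Definition L_seq (V : finType) (e : rel V) (k : nat) (s : k.-tuple V) :=
  grundy_seq (cln e) (opn e) s.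

(* A sequence of distinct vertices has length at most [#|V|], so bounding [k]
   loses nothing, and [#|V| - max_length P] is never truncated.  The empty
   sequence is allowed. *)
Definition max_length (V : finType)
    (P : forall k : nat, k.-tuple V -> bool) : nat :=
  \max_(k < #|V|.+1 | [exists s : k.-tuple V, P k s]) k.

Definition grundy_Z (V : finType) (e : rel V) := max_length (@Z_seq V e).
Definition grundy (V : finType) (e : rel V) :=
  max_length (@dominating_seq V e).
Definition grundy_t (V : finType) (e : rel V) :=
  max_length (@total_dominating_seq V e).
Definition grundy_L (V : finType) (e : rel V) := max_length (@L_seq V e).

(* Main.v *)
(* If [x_1] forces [y_1], ..., [x_k] forces [y_k] in this order, then
   [(y_k, ..., y_1)] is a sequence of the matching type: [x_i] is a neighbor of
   [y_i], and it is not a neighbor of any [y_j] with [j > i] because these are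
   still white when [x_i] forces [y_i].  The converse is the same computation.
   Listing the forced vertices backwards, rather than the forcing vertices
   forwards, matters for [Z_L], where a vertex may force both a neighbor and
   itself. *)
Require Import Defs.
From mathcomp Require Import all_boot.
Set Implicit Arguments.
Unset Strict Implicit.
Unset Printing Implicit Defensive.

Section ForcingGrundy.

Variables (V : finType) (A C : V -> {set V}).

(* [l] is a Grundy sequence listed from its last vertex to its first. *)
Fixpoint rev_grundy (l : seq V) : bool :=
  if l is y :: l' then
    [&& y \notin l', A y :\: \bigcup_(u in l') C u != set0 & rev_grundy l']
  else true.

Lemma rev_grundy_uniq l : rev_grundy l -> uniq l.
Proof. by elim: l => //= y l IHl /and3P[-> _ /IHl]. Qed.

(** Induction from the right: appending a vertex leaves the conditions at earlier indices unchanged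
    and adds one at index [size s], the head condition of the reversed list. *)
Lemma rev_grundyE x0 s :
  rev_grundy (rev s) = uniq s &&
    all (fun i => A (nth x0 s i) :\: \bigcup_(u in take i s) C u != set0)
        (iota 0 (size s)).
Proof.
elim/last_ind: s => [//|s y IHs].
rewrite rev_rcons /= IHs mem_rev rcons_uniq size_rcons -addn1 iotaD all_cat /=.
rewrite nth_rcons ltnn eqxx -cats1 take_size_cat // andbT.
have -> : \bigcup_(u in rev s) C u = \bigcup_(u in s) C u.
  by apply: eq_bigl => u; rewrite mem_rev.
have -> : all (fun i => A (nth x0 (s ++ [:: y]) i)
                :\: \bigcup_(u in take i (s ++ [:: y])) C u != set0)
              (iota 0 (size s)) =
          all (fun i => A (nth x0 s i) :\: \bigcup_(u in take i s) C u != set0)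
              (iota 0 (size s)).
  apply: eq_in_all => i; rewrite mem_iota /= add0n => lt_i.
  by rewrite nth_cat lt_i takel_cat // ltnW.
by rewrite -!andbA; congr (_ && _); rewrite andbC -andbA.
Qed.

Lemma grundy_seqE k (s : k.-tuple V) : grundy_seq A C s = rev_grundy (rev s).
Proof.
(* The empty tuple is treated apart, since [tnth s ord0] serves as the default of [nth] below. *)
case: k s => [|k] s; first by rewrite tuple0 /grundy_seq; apply/forallP; case.
rewrite (rev_grundyE (tnth s ord0)) /grundy_seq; congr (_ && _).
have bigcup_take (i : 'I_k.+1) :
    \bigcup_(j < k.+1 | j < i) C (tnth s j) = \bigcup_(u in take i s) C u.
  apply/setP => z; apply/bigcupP/bigcupP => [[j lt_ji zj]|[u u_s zu]].
    exists (tnth s j) => //; rewrite (tnth_nth (tnth s ord0)).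
    by rewrite -(nth_take _ lt_ji) mem_nth // size_take size_tuple ltn_ord.
  have := u_s; rewrite -index_mem size_take size_tuple ltn_ord => lt_ui.
  have lt_uk := ltn_trans lt_ui (ltn_ord i).
  exists (Ordinal lt_uk) => //; rewrite (tnth_nth (tnth s ord0)) /=.
  by rewrite -(nth_take _ lt_ui) nth_index.
apply/forallP/allP => [sP i|sP i].
  rewrite mem_iota size_tuple /= add0n => lt_ik.
  by have := sP (Ordinal lt_ik); rewrite bigcup_take (tnth_nth (tnth s ord0)).
rewrite bigcup_take (tnth_nth (tnth s ord0)); apply: sP.
by rewrite mem_iota size_tuple /= add0n.
Qed.

Variable ccr : color_rule V.
Hypothesis A_sym : forall x y, (y \in A x) = (x \in A y).
Hypothesis C_sym : forall x y, (y \in C x) = (x \in C y).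
(** Common form of the four rules. Inclusion replaces equality because [y] may lie outside [C x], as
    when a vertex forces itself under [ccr_ZL]; then [C x] must be entirely blue. *)
Hypothesis ccrE : forall B x y,
  ccr B x y = [&& y \in A x, y \notin B & C x :\: B \subset [set y]].

(** The same [x] witnesses both sides: by symmetry, [C x] avoids [l] exactly when [x] lies in no
    [C u] with [u] in [l]. *)
Lemma rev_grundy_step B l y : y \notin l -> B = ~: [set:: y :: l] ->
  [exists x, ccr B x y] = (A y :\: \bigcup_(u in l) C u != set0).
Proof.
move=> y_l ->; have y_white : y \notin ~: [set:: y :: l].
  by rewrite !inE eqxx.
apply/existsP/set0Pn => -[x].
  rewrite ccrE y_white /= => /andP[Axy /subsetP sub].
  exists x; rewrite inE -A_sym Axy andbT; apply/bigcupP => -[u u_l].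
  rewrite C_sym => Cxu; have := sub u.
  rewrite !inE Cxu u_l orbT => /(_ isT)/eqP uy.
  by rewrite -uy u_l in y_l.
rewrite inE => /andP[/bigcupP nC Ayx]; exists x; rewrite ccrE y_white A_sym Ayx /=.
apply/subsetP => u; rewrite !inE negbK => /andP[/orP[//|u_l] Cxu].
by case: nC; exists u; rewrite // C_sym.
Qed.

Lemma rev_grundy_forcing l : rev_grundy l -> zero_forcing ccr (~: [set:: l]).
Proof.
elim: l => [_|y l IHl /= /and3P[y_l Ay /IHl zf_l]].
  have -> : ~: [set:: [::]] = [set: V] by apply/setP => x; rewrite !inE.
  exact: zero_forcingT.
apply: connect_trans zf_l; apply: connect1.
move: Ay; rewrite -(rev_grundy_step y_l erefl) => /existsP[x xy].
apply/existsP; exists x; apply/existsP; exists y; rewrite xy /=.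
apply/eqP/setP => z; rewrite !inE negb_or.
by case: eqVneq => [->|].
Qed.

(** Induction along the path of color changes, consing each forced vertex onto the list of those
    forced later. *)
Lemma forcing_rev_grundy B : zero_forcing ccr B ->
  exists2 l, rev_grundy l & B = ~: [set:: l].
Proof.
case/connectP => p; elim: p B => [|B' p IHp] B /=.
  by move=> _ <-; exists [::] => //; apply/setP => x; rewrite !inE.
case/andP => /existsP[x /existsP[y /andP[xy /eqP defB']]] pB' lastB'.
have [l l_ok defl] := IHp _ pB' lastB'.
have y_B : y \notin B by move: xy; rewrite ccrE => /and3P[].
(* [y] is blue in [B'], whereas [l] lists the white vertices of [B']. *)
have y_l : y \notin l.
  by have := setU11 y B; rewrite -defB' defl !inE.
have defB : B = ~: [set:: y :: l].
  apply/setP => z; have /setP/(_ z) := etrans (esym defB') defl.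
  rewrite !inE negb_or; case: eqVneq => [->|] //= _.
  exact: negbTE.
exists (y :: l) => //=; rewrite y_l l_ok andbT /=.
by rewrite -(rev_grundy_step y_l defB); apply/existsP; exists x.
Qed.

Lemma card_setC_seq (l : seq V) : uniq l -> #|~: [set:: l]| = #|V| - size l.
Proof. by move=> l_uniq; rewrite cardsCs setCK cardsE (card_uniqP l_uniq). Qed.

(** Zero forcing sets are exactly the complements of reversed Grundy lists, so a smallest set
    matches a longest list. *)
Lemma forcing_number_grundy :
  forcing_number ccr = #|V| - max_length (@grundy_seq V A C).
Proof.
rewrite /forcing_number; case: arg_minnP => [|B zf_B minB].
  exact: zero_forcingT.
have [l l_ok defB] := forcing_rev_grundy zf_B.
have l_uniq := rev_grundy_uniq l_ok.
have le_l : size l <= #|V| by rewrite -(card_uniqP l_uniq) max_card.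
rewrite defB card_setC_seq //; congr (_ - _); apply/eqP; rewrite eqn_leq.
apply/andP; split.
  have lt_l : size l < #|V|.+1 by [].
  rewrite /max_length -[size l]/(nat_of_ord (Ordinal lt_l)).
  apply: leq_bigmax_cond; apply/existsP.
  have size_rl : size (rev l) == size l by rewrite size_rev.
  by exists (Tuple size_rl); rewrite grundy_seqE /= revK.
apply/bigmax_leqP => k /existsP[s]; rewrite grundy_seqE => s_ok.
have := minB _ (rev_grundy_forcing s_ok).
rewrite defB !card_setC_seq ?rev_grundy_uniq // size_rev size_tuple.
(* Cancelling the truncated subtractions needs [k <= #|V|], which is the ordinal bound on [k]. *)
by rewrite leq_sub2lE // -ltnS.
Qed.

End ForcingGrundy.

Lemma all_blue_exceptE (V : finType) (B S : {set V}) y : y \in S ->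
  all_blue_except B S y = (y \notin B) && (S :\: B \subset [set y]).
Proof.
by move=> Sy; rewrite /all_blue_except eqEsubset sub1set inE Sy andbT andbC.
Qed.

Section Graph.

Variables (V : finType) (e : rel V).
Hypothesis e_sym : symmetric e.

Lemma opn_sym x y : (y \in opn e x) = (x \in opn e y).
Proof. by rewrite !inE e_sym. Qed.

Lemma cln_sym x y : (y \in cln e x) = (x \in cln e y).
Proof. by rewrite !inE e_sym eq_sym. Qed.

Lemma opn_sub_cln x y : y \in opn e x -> y \in cln e x.
Proof. exact: setU1r. Qed.

(** If [x = y], adding [x] to the open neighborhood does not affect inclusion in [[set x]];
    otherwise [y] lies in the closed neighborhood of [x] only as a neighbor. *)
Lemma ccr_ZLE B x y : ccr_ZL e B x y =
  [&& y \in cln e x, y \notin B & opn e x :\: B \subset [set y]].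
Proof.
rewrite /ccr_ZL /ccr_Zminus /ccr_Zl; case: eqVneq => [<-|ne_xy] /=.
  rewrite setU11 /= all_blue_exceptE ?setU11 //; congr (_ && _).
  by rewrite setDUl subUset subsetDl.
rewrite orbF !inE eq_sym (negbTE ne_xy) /=.
by case exy: (e x y) => //=; rewrite all_blue_exceptE // inE.
Qed.

End Graph.

Theorem theorem2p2 (V : finType) (e : rel V) (n : nat)
    (e_sym : symmetric e) (e_irr : irreflexive e) (V_card : #|V| = n) :
  [/\ Z_number e = n - grundy_Z e,
      Zl_number e = n - grundy e,
      Zminus_number e = n - grundy_t e
    & ZL_number e = n - grundy_L e].
Proof.
rewrite -V_card; have [oS cS] := (opn_sym e_sym, cln_sym e_sym).
(* Unification takes ([A], [C]) to be (open, closed), (closed, closed), (open, open), (closed, open)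
   in turn; what remains is [ccrE] for each rule. *)
split; apply: forcing_number_grundy => // B x y.
- by apply: andb_id2l => xy; rewrite all_blue_exceptE // opn_sub_cln.
- by apply: andb_id2l => xy; rewrite all_blue_exceptE.
- by apply: andb_id2l => xy; rewrite all_blue_exceptE.
- exact: ccr_ZLE.
Qed.
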